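(* Let $\mathfrak{d}\geq 3$ be an integer, $c>0$, $\lambda>0$, and let $p_{\mathbf{Y}_{\mathfrak{d}}}(\mathbf{y},t)$ denote the density of the absolutely continuous component of the law of the random flight $\mathbf{Y}_{\mathfrak{d}}(t)$ described in the context. Define, for $t>0$ and $\|\mathbf{y}\|<ct$, $$f(\mathbf{y},t)=\pi^{\mathfrak{d}/2}(ct)^{\mathfrak{d}-2}E_{\frac{\mathfrak{d}}{2}-1,\frac{\mathfrak{d}}{2},\frac{\mathfrak{d}}{2}-1,\frac{\mathfrak{d}-1}{2}}\!\left(\left(\tfrac{\lambda t}{2}\right)^{\mathfrak{d}-2}\right)p_{\mathbf{Y}_{\mathfrak{d}}}(\mathbf{y},t).$$ Then $$f(\mathbf{y},t)=\sum_{k=1}^{\infty}\left(\frac{\lambda}{2c}\right)^{k(\mathfrak{d}-2)}\frac{\left(\sqrt{c^2t^2-\|\mathbf{y}\|^2}\right)^{k(\mathfrak{d}-2)-2}}{\Gamma\!\left(k(\frac{\mathfrak{d}}{2}-1)\right)\Gamma\!\left(\frac{\mathfrak{d}-1}{2}+(\frac{\mathfrak{d}}{2}-1)k\right)},$$ and $u=f$ solves the higher order non-homogeneous Klein–Gordon equation $$\left(\frac{\partial^2}{\partial t^2}-c^2\Delta\right)^{\mathfrak{d}-2}u(\mathbf{y},t)=\lambda^{2(\mathfrak{d}-2)}u(\mathbf{y},t)+(2\lambda c)^{\mathfrak{d}-2}\frac{(c^2t^2-\|\mathbf{y}\|^2)^{-\mathfrak{d}/2}}{\sqrt{\pi}\,\Gamma(1-\frac{\mathfrak{d}}{2})},\qquad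 \Delta=\sum_{j=1}^{\mathfrak{d}}\frac{\partial^2}{\partial y_j^2},$$ in the region $\{(\mathbf{y},t):t>0,\ \|\mathbf{y}\|<ct\}$.
   Context: Random flight $\mathbf{Y}_{\mathfrak{d}}(t)$ in $\mathbb{R}^{\mathfrak{d}}$: a particle starts at the origin at time $0$ and moves with constant speed $c>0$; it changes direction $\mathcal{N}_{\mathfrak{d}}(t)$ times in $(0,t)$; successive directions are independent and uniform on $S^{\mathfrak{d}-1}$. Given $\mathcal{N}_{\mathfrak{d}}(t)=k$, the segment durations $\tau_1,\dots,\tau_{k+1}$ ($\tau_{k+1}=t-\sum_{j=1}^k\tau_j$) have joint density $\frac{\Gamma((k+1)(\frac{\mathfrak{d}}{2}-1))}{\Gamma(\frac{\mathfrak{d}}{2}-1)^{k+1}}\frac{1}{t^{(k+1)(\frac{\mathfrak{d}}{2}-1)-1}}\prod_{j=1}^{k+1}\tau_j^{\frac{\mathfrak{d}}{2}-2}$ (Dirichlet with parameters $(\frac{\mathfrak{d}}{2}-1,\dots,\frac{\mathfrak{d}}{2}-1)$ rescaled to total $t$), independent of the directions. The number of changes has law $P\{\mathcal{N}_{\mathfrak{d}}(t)=k\}=\frac{1}{E_{\mathfrak{d}-2,\mathfrak{d}-1}((\lambda t)^{\mathfrak{d}-2})}\frac{(\lambda t)^{k(\mathfrak{d}-2)}}{\Gamma((\mathfrak{d}-2)k+\mathfrak{d}-1)}$, $k=0,1,\dots$, with $E_{\alpha,\beta}(x)=\sum_{k\ge0}x^k/\Gamma(\alpha k+\beta)$. It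 is known that for $k\geq1$ the conditional density of $\mathbf{Y}_{\mathfrak{d}}(t)$ given $\mathcal{N}_{\mathfrak{d}}(t)=k$ is $p(\mathbf{y},t;k)=\frac{\Gamma((k+1)(\frac{\mathfrak{d}}{2}-1)+1)}{\Gamma(k(\frac{\mathfrak{d}}{2}-1))}\frac{(c^2t^2-\|\mathbf{y}\|^2)^{k(\frac{\mathfrak{d}}{2}-1)-1}}{\pi^{\mathfrak{d}/2}(ct)^{2(k+1)(\frac{\mathfrak{d}}{2}-1)}}$ on $\|\mathbf{y}\|<ct$, and $p_{\mathbf{Y}_{\mathfrak{d}}}(\mathbf{y},t)=\sum_{k\geq1}p(\mathbf{y},t;k)P\{\mathcal{N}_{\mathfrak{d}}(t)=k\}$. The multi-index Mittag-Leffler function is $E_{\frac{\mathfrak{d}}{2}-1,\frac{\mathfrak{d}}{2},\frac{\mathfrak{d}}{2}-1,\frac{\mathfrak{d}-1}{2}}(z)=\sum_{k=0}^\infty\frac{z^k}{\Gamma((k+1)(\frac{\mathfrak{d}}{2}-1)+1)\Gamma(\frac{\mathfrak{d}-1}{2}+(\frac{\mathfrak{d}}{2}-1)k)}$. Convention: $1/\Gamma(-n)=0$ for nonnegative integers $n$, so the inhomogeneous term vanishes for even $\mathfrak{d}$. *)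

(* Defs.v *)
From Stdlib Require Import Reals.
From Coquelicot Require Import Coquelicot.
From mathcomp Require Import ssreflect ssrbool eqtype ssrnat fintype bigop.
Set Implicit Arguments.
Unset Strict Implicit.
Unset Printing Implicit Defensive.
Open Scope R_scope.

Definition Gamma (s : R) : R :=
  RInt_gen (fun x => Rpower x (s - 1) * exp (- x)) (at_right 0) (Rbar_locally p_infty).

Fixpoint poch (s : R) (n : nat) : R :=
  match n with
  | O => 1
  | S m => poch s m * (s + INR m)
  end.

(** Reciprocal Gamma function 1/Gamma(s) on all of R, via Gamma(s+n) = poch s n * Gamma s
    with n the least natural number such that s + n > 0.  It vanishes exactly at
    s = 0, -1, -2, ... (convention 1/Gamma(-n) = 0). For s > 0 it is 1 / Gamma s. *)
Definition rGamma (s : R) : R :=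
  let n := Z.to_nat (up (- s)) in poch s n / Gamma (s + INR n).

Definition ML2 (a b x : R) : R := Series (fun k => x ^ k * rGamma (a * INR k + b)).

Definition MML (d : nat) (z : R) : R :=
  Series (fun k => z ^ k
    * rGamma ((INR k + 1) * (INR d / 2 - 1) + 1)
    * rGamma ((INR d - 1) / 2 + (INR d / 2 - 1) * INR k)).

Definition vnorm (d : nat) (y : 'I_d -> R) : R :=
  sqrt (\big[Rplus/0]_(j < d) (y j * y j)).

Definition probN (d : nat) (lam t : R) (k : nat) : R :=
  (lam * t) ^ (k * (d - 2)) * rGamma (INR ((d - 2) * k + d - 1))
  / ML2 (INR (d - 2)) (INR (d - 1)) ((lam * t) ^ (d - 2)).

(** Conditional density p(y,t;k), k >= 1, on ||y|| < ct. *)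
Definition pcond (d : nat) (c : R) (y : 'I_d -> R) (t : R) (k : nat) : R :=
  Gamma ((INR k + 1) * (INR d / 2 - 1) + 1) * rGamma (INR k * (INR d / 2 - 1))
  * Rpower (c ^ 2 * t ^ 2 - vnorm y ^ 2) (INR k * (INR d / 2 - 1) - 1)
  / (Rpower PI (INR d / 2) * Rpower (c * t) (2 * (INR k + 1) * (INR d / 2 - 1))).

Definition pY (d : nat) (c lam : R) (y : 'I_d -> R) (t : R) : R :=
  Series (fun k => pcond c y t k.+1 * probN d lam t k.+1).

Definition fKG (d : nat) (c lam : R) (y : 'I_d -> R) (t : R) : R :=
  Rpower PI (INR d / 2) * (c * t) ^ (d - 2)
  * MML d ((lam * t / 2) ^ (d - 2)) * pY c lam y t.

(** Partial derivatives of u : R^d x R -> R.  Direction [None] is time t,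
    direction [Some j] is the spatial coordinate y_j. *)
Definition upd (d : nat) (y : 'I_d -> R) (j : 'I_d) (s : R) : 'I_d -> R :=
  fun i => if i == j then s else y i.

Definition slice (d : nat) (o : option 'I_d) (u : ('I_d -> R) -> R -> R)
  (y : 'I_d -> R) (t : R) : R -> R :=
  match o with
  | None => fun s => u y s
  | Some j => fun s => u (upd y j s) t
  end.

Definition coord (d : nat) (o : option 'I_d) (y : 'I_d -> R) (t : R) : R :=
  match o with None => t | Some j => y j end.

Definition pd (d : nat) (o : option 'I_d) (u : ('I_d -> R) -> R -> R)
  : ('I_d -> R) -> R -> R :=
  fun y t => Derive (slice o u y t) (coord o y t).

Definition pdl (d : nat) (l : list (option 'I_d)) (u : ('I_d -> R) -> R -> R)
  : ('I_d -> R) -> R -> R :=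
  List.fold_right (fun o v => pd o v) u l.

Definition smooth_on (d : nat) (D : ('I_d -> R) -> R -> Prop)
  (u : ('I_d -> R) -> R -> R) : Prop :=
  forall (l : list (option 'I_d)) (o : option 'I_d) y t,
    D y t -> ex_derive (slice o (pdl l u) y t) (coord o y t).

Definition KG (d : nat) (c : R) (u : ('I_d -> R) -> R -> R)
  : ('I_d -> R) -> R -> R :=
  fun y t => pd None (pd None u) y t
             - c ^ 2 * \big[Rplus/0]_(j < d) pd (Some j) (pd (Some j) u) y t.

Definition cone (d : nat) (c : R) (y : 'I_d -> R) (t : R) : Prop :=
  0 < t /\ vnorm y < c * t.

(* Main.v *)
Require Import Defs.
From HB Require Import structures.
From Stdlib Require Import Reals FunctionalExtensionality ZArith Lra Lia.
From Coquelicot Require Import Coquelicot.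
From mathcomp Require Import ssreflect ssrfun ssrbool eqtype ssrnat fintype bigop.
From mathcomp Require Import zify.
Open Scope R_scope.

(** With N = d - 2, w = c^2 t^2 - |y|^2 and g(m) = 1/Gamma(m/2), the flight density times
    its prefactor is f = sum_k A_k w^(kN/2 - 1), A_k = (lam/2c)^(kN) g(kN) g(kN + N + 1), by
    the duplication formula, which is needed only at half-integers and hence follows from
    Gamma(1) = 1, Gamma(1/2) = sqrt(pi) and the recurrence. The operator multiplies w^b by
    4 c^2 b (b + (d-1)/2) w^(-1); applied N times it lowers both Gamma arguments by N, so
    the k-th term becomes lam^(2N) times the (k-2)-nd one. The term k = 0 vanishes
    and k = 1 is the inhomogeneity. *)

(** * The Gamma function at half-integers *)

(** The Gamma arguments grow by N/2 per term, so a shift by one term would take N/2 applications of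
    the operator; N applications shift by two terms whatever the parity of N, whence the order d -
    2. The difficulty is analytic. [Gamma], [Series] and [Derive] are total, so convergence and
    differentiability are proved separately. For odd d half-integral powers of w occur; f is
    therefore kept as an entire power series in (sqrt w)^N divided by a power of sqrt w, a family
    stable under d/dw on w > 0. Its coefficients decay fast enough by the recurrence g(n) = (n/2)
    g(n+2) alone, in place of Stirling's formula. *)

Lemma is_RInt_gen_antiderivative (F f : R -> R) (la lb : R) :
  (forall x, 0 < x -> is_derive F x (f x)) ->
  (forall x, 0 < x -> continuous f x) ->
  filterlim F (at_right 0) (locally la) ->
  filterlim F (Rbar_locally p_infty) (locally lb) ->
  is_RInt_gen f (at_right 0) (Rbar_locally p_infty) (lb - la).
Proof.
move=> dF cf l0 l1.
(* Eventually both end points are positive, so the interval between them avoids 0, where nothing is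
   assumed of [F]. *)
have pos : filter_prod (at_right 0) (Rbar_locally p_infty)
    (fun ab : R * R => forall x, Rmin (fst ab) (snd ab) <= x -> 0 < x).
  apply: (Filter_prod _ _ _ (fun a => 0 < a) (fun b => 0 < b)).
  - by exists (mkposreal 1 Rlt_0_1) => y _.
  - by exists 0.
  - by move=> a b /= a0 b0 x; apply: Rlt_le_trans; apply: Rmin_pos.
have dE x : 0 < x -> Derive F x = f x by move=> x0; apply: is_derive_unique; apply: dF.
apply: (is_RInt_gen_ext (Derive F)).
  by apply: filter_imp pos => -[a b] /= h x [hx _]; apply: dE; apply: h; lra.
apply: is_RInt_gen_Derive => //.
- by apply: filter_imp pos => -[a b] /= h x [hx _]; exists (f x); apply: dF; apply: h.
- apply: filter_imp pos => -[a b] /= h x [hx _].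
  have x0 := h x hx.
  apply: (continuous_ext_loc _ f _ _ (cf x x0)).
  exists (mkposreal x x0) => y.
  rewrite /ball /= /AbsRing_ball /abs /minus /plus /opp /=.
  by move/Rabs_def2 => hy; rewrite dE //; lra.
Qed.

Lemma Rpower_at_right0 (s : R) : 0 < s ->
  filterlim (fun x => Rpower x s) (at_right 0) (locally 0).
Proof.
move=> s0; apply/filterlim_locally => eps.
have e0 := cond_pos eps.
exists (mkposreal (Rpower eps (/ s)) (exp_pos _)) => y.
rewrite /ball /= /AbsRing_ball /abs /minus /plus /opp /=.
move/Rabs_def2 => [hy _] y0.
have p0 : 0 < Rpower y s by apply: exp_pos.
have -> : Rpower y s + - 0 = Rpower y s by ring.
rewrite Rabs_pos_eq; last by lra.
have -> : (eps : R) = Rpower (Rpower eps (/ s)) s.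
  by rewrite Rpower_mult Rinv_l ?Rpower_1 //; lra.
by apply: Rlt_Rpower_l => //; lra.
Qed.

(** In the form exp(-x (1 - s ln x / x)) the exponent tends to minus infinity, because ln x / x
    tends to 0. *)
Lemma Rpower_exp_at_infty (s : R) :
  filterlim (fun x => Rpower x s * exp (- x)) (Rbar_locally p_infty) (locally 0).
Proof.
have h : is_lim (fun x => exp ((- x) * (1 - s * (ln x / x)))) p_infty 0.
  apply: (is_lim_comp exp _ p_infty 0 m_infty).
  - exact: is_lim_exp_m.
  - have -> : m_infty = Rbar_mult (Rbar_opp p_infty) (1 - s * 0).
      have -> : 1 - s * 0 = 1 by ring.
      rewrite /= /Rbar_mult /=.
      by case: Rle_dec => [h|h]; [case: Rle_lt_or_eq_dec => [h'|h']|]; rewrite ?/=; try lra.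
    apply: is_lim_mult.
    + by apply: is_lim_opp; apply: is_lim_id.
    + apply: is_lim_minus'; first exact: is_lim_const.
      apply: (is_lim_scal_l _ s p_infty 0).
      exact: is_lim_div_ln_p.
    + by rewrite /=; lra.
  - by exists 0.
apply: filterlim_ext_loc h.
exists 0 => x x0.
by rewrite /Rpower -exp_plus; congr exp; field; lra.
Qed.

Lemma is_derive_Rpower_exp (s x : R) : 0 < x ->
  is_derive (fun x => - (Rpower x s * exp (- x))) x
    (Rpower x s * exp (- x) - s * (Rpower x (s - 1) * exp (- x))).
Proof.
move=> x0.
have -> : Rpower x (s - 1) = Rpower x s * / x.
  by rewrite /Rminus Rpower_plus Rpower_Ropp Rpower_1.
by rewrite /Rpower; auto_derive => //; field; lra.
Qed.

Lemma continuous_Gamma_integrand (s x : R) : 0 < x ->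
  continuous (fun x => Rpower x (s - 1) * exp (- x)) x.
Proof.
move=> x0; apply: ex_derive_continuous.
by rewrite /Rpower; auto_derive.
Qed.

(** A relation, so that convergence is part of the claim; an equation for the total [Gamma] would
    not record it. *)
Definition is_Gamma (s l : R) : Prop :=
  is_RInt_gen (fun x => Rpower x (s - 1) * exp (- x)) (at_right 0) (Rbar_locally p_infty) l.

Lemma is_Gamma_unique (s l : R) : is_Gamma s l -> Gamma s = l.
Proof. by move=> h; rewrite /Gamma (is_RInt_gen_unique _ _ h). Qed.

(** Integration by parts: the derivative of -x^s exp(-x) integrates to 0, as both boundary terms
    vanish for s > 0, and it is the integrand at s + 1 minus s times the integrand at s. *)
Lemma is_Gamma_succ (s l : R) : 0 < s -> is_Gamma s l -> is_Gamma (s + 1) (s * l).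
Proof.
move=> s0 hl.
have h0 : is_RInt_gen (fun x => Rpower x s * exp (- x) - s * (Rpower x (s - 1) * exp (- x)))
   (at_right 0) (Rbar_locally p_infty) (0 - 0).
  apply: (is_RInt_gen_antiderivative (fun x => - (Rpower x s * exp (- x)))).
  - by move=> x; apply: is_derive_Rpower_exp.
  - move=> x x0; apply: ex_derive_continuous.
    by rewrite /Rpower; auto_derive.
  - have e : - (0 * exp (- 0)) = 0 by ring.
    rewrite -[X in locally X]e.
    apply: (filterlim_comp _ _ _ _ (fun x : R => - x) _ (locally (0 * exp (- 0)))); last first.
      exact: filterlim_opp.
    have h2 : filterlim (fun x => exp (- x)) (at_right 0) (locally (exp (- 0))).
      apply: (filterlim_filter_le_1 (F := locally 0)).
        exact: filter_le_within.
      have : continuous (fun x => exp (- x)) 0 by apply: ex_derive_continuous; auto_derive.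
      by [].
    exact (filterlim_comp_2 _ _ Rmult (Rpower_at_right0 s s0) h2 (filterlim_mult 0 (exp (- 0)))).
  - rewrite -[X in locally X]Ropp_0.
    apply: (filterlim_comp _ _ _ _ (fun x : R => - x) _ (locally 0)); last first.
      exact: filterlim_opp.
    exact: Rpower_exp_at_infty.
have h1 := is_RInt_gen_plus _ _ _ _ h0 (is_RInt_gen_scal _ s _ hl).
have e : plus (0 - 0) (scal s l) = s * l by rewrite /plus /scal /= /mult /=; ring.
rewrite e in h1.
rewrite /is_Gamma; apply: (is_RInt_gen_ext _ _ _ _ (h1 _ _ _ _)); apply: filter_forall => ab x _.
rewrite /plus /scal /= /mult /=.
have -> : s + 1 - 1 = s by ring.
ring.
Qed.

Lemma is_Gamma_1 : is_Gamma 1 1.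
Proof.
rewrite /is_Gamma.
have e : 0 - - (exp (- 0)) = 1 by rewrite Ropp_0 exp_0; ring.
rewrite -[X in is_RInt_gen _ _ _ X]e.
apply: (is_RInt_gen_antiderivative (fun x => - exp (- x))).
- move=> x x0.
  have -> : Rpower x (1 - 1) = 1 by rewrite Rminus_diag Rpower_O.
  by auto_derive => //; ring.
- by move=> x; apply: continuous_Gamma_integrand.
- apply: (filterlim_filter_le_1 (F := locally 0)); first exact: filter_le_within.
  have : continuous (fun x => - exp (- x)) 0.
    by apply: ex_derive_continuous; auto_derive.
  by [].
- rewrite -[X in locally X]Ropp_0.
  apply: (filterlim_comp _ _ _ _ (fun x : R => - x) _ (locally 0)); last first.
    exact: filterlim_opp.
  have h := Rpower_exp_at_infty 0.
  apply: filterlim_ext_loc h.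
  by exists 0 => x x0; rewrite Rpower_O // Rmult_1_l.
Qed.

(** * The Gaussian integral and Gamma(1/2) *)

Definition gauss_int (x : R) : R := RInt (fun v => exp (- v ^ 2)) 0 x.

(** The auxiliary kernel of the classical one-variable proof: its integral over [0, 1] decreases
    exactly as the square of [gauss_int] grows. *)
Definition gauss_ker (x t : R) : R := exp (- (x ^ 2 * (1 + t ^ 2))) / (1 + t ^ 2).

Lemma ex_RInt_gauss (a b : R) : ex_RInt (fun v => exp (- v ^ 2)) a b.
Proof.
apply: (ex_RInt_continuous (V := R_CompleteNormedModule)) => z _.
by apply: ex_derive_continuous; auto_derive.
Qed.

Lemma one_plus_sqr_gt0 (t : R) : 0 < 1 + t ^ 2.
Proof. by have := pow2_ge_0 t; lra. Qed.

Lemma is_derive_gauss_int (x : R) : is_derive gauss_int x (exp (- x ^ 2)).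
Proof.
apply: (is_derive_RInt (fun v => exp (- v ^ 2)) _ 0).
  by apply: filter_forall => b; apply: RInt_correct; apply: ex_RInt_gauss.
by apply: ex_derive_continuous; auto_derive.
Qed.

Lemma ex_RInt_gauss_ker (x : R) : ex_RInt (gauss_ker x) 0 1.
Proof.
apply: (ex_RInt_continuous (V := R_CompleteNormedModule)) => z _.
apply: ex_derive_continuous; rewrite /gauss_ker; auto_derive.
by have := one_plus_sqr_gt0 z; lra.
Qed.

Lemma is_derive_gauss_ker (x t : R) :
  is_derive (fun x => gauss_ker x t) x (- 2 * x * exp (- (x ^ 2 * (1 + t ^ 2)))).
Proof.
have t0 := one_plus_sqr_gt0 t.
rewrite /gauss_ker; auto_derive => //.
rewrite -[x * (x * 1)]/(x ^ 2) -[t * (t * 1)]/(t ^ 2).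
by field; lra.
Qed.

(** Differentiation under the integral sign cancels the denominator 1 + t^2; the substitution v = x
    t then produces [gauss_int x]. *)
Lemma is_derive_RInt_gauss_ker (x : R) :
  is_derive (fun x => RInt (gauss_ker x) 0 1) x (- 2 * exp (- x ^ 2) * gauss_int x).
Proof.
have dE u v : Derive (fun z => gauss_ker z v) u = - 2 * u * exp (- (u ^ 2 * (1 + v ^ 2))).
  by apply: is_derive_unique; apply: is_derive_gauss_ker.
have -> : - 2 * exp (- x ^ 2) * gauss_int x =
    RInt (fun t => Derive (fun u => gauss_ker u t) x) 0 1.
  rewrite /gauss_int.
  have := @RInt_comp_lin R_CompleteNormedModule (fun v => exp (- v ^ 2)) x 0 0 1 (ex_RInt_gauss _ _).
  rewrite !Rplus_0_r Rmult_0_r Rmult_1_r => <-.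
  set g := fun y => scal x _; set A := - 2 * exp (- x ^ 2).
  have -> : A * RInt g 0 1 = RInt (fun t => scal A (g t)) 0 1.
    rewrite RInt_scal //.
    apply: (ex_RInt_continuous (V := R_CompleteNormedModule)) => z _.
    by apply: ex_derive_continuous; rewrite /g /scal /= /mult /=; auto_derive.
  apply: RInt_ext => t _.
  rewrite dE /g /A /scal /= /mult /=.
  have -> : - (x * (x * 1) * (1 + t * (t * 1))) = - (x * (x * 1)) + - ((x * t + 0) * ((x * t + 0) * 1)) by ring.
  by rewrite exp_plus; ring.
apply: (is_derive_RInt_param gauss_ker).
- by apply: filter_forall => y t _; eexists; apply: is_derive_gauss_ker.
- move=> t _.
  apply: (continuity_2d_pt_ext (fun u v => - 2 * u * exp (- ((u * u) * (1 + v * v))))).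
    by move=> u v; rewrite dE /=; congr (_ * exp _); ring.
  apply: continuity_2d_pt_mult.
    apply: continuity_2d_pt_mult; first exact: continuity_2d_pt_const.
    exact: continuity_2d_pt_id1.
  apply: (continuity_1d_2d_pt_comp exp).
    by apply: derivable_continuous_pt; apply: derivable_pt_exp.
  apply: continuity_2d_pt_opp; apply: continuity_2d_pt_mult.
    by apply: continuity_2d_pt_mult; apply: continuity_2d_pt_id1.
  apply: continuity_2d_pt_plus; first exact: continuity_2d_pt_const.
  by apply: continuity_2d_pt_mult; apply: continuity_2d_pt_id2.
- by apply: filter_forall => y; apply: ex_RInt_gauss_ker.
Qed.

(* Both sides have derivative zero, and at 0 the left side is the integral of 1/(1+t^2). *)
Lemma gauss_int_sqr (x : R) : 0 <= x -> gauss_int x ^ 2 + RInt (gauss_ker x) 0 1 = PI / 4.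
Proof.
pose S x := gauss_int x ^ 2 + RInt (gauss_ker x) 0 1.
have dS y : is_derive S y 0.
  have -> : 0 = plus (INR 2 * exp (- y ^ 2) * gauss_int y ^ 1) (- 2 * exp (- y ^ 2) * gauss_int y).
    by rewrite /plus /=; ring.
  apply: (is_derive_plus (fun x => gauss_int x ^ 2)); last exact: is_derive_RInt_gauss_ker.
  by apply: (is_derive_pow gauss_int 2); apply: is_derive_gauss_int.
have S0 : S 0 = PI / 4.
  rewrite /S /gauss_int RInt_point.
  have -> : RInt (gauss_ker 0) 0 1 = atan 1 - atan 0.
    apply: is_RInt_unique.
    apply: (is_RInt_derive atan) => t _.
      have -> : gauss_ker 0 t = / (1 + t²).
        rewrite /gauss_ker.
        have -> : - (0 ^ 2 * (1 + t ^ 2)) = 0 by ring.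
        by rewrite exp_0 Rsqr_pow2 /Rdiv Rmult_1_l.
      exact: is_derive_atan.
    apply: ex_derive_continuous; rewrite /gauss_ker; auto_derive.
    by have := one_plus_sqr_gt0 t; lra.
  by rewrite atan_1 atan_0 /zero /=; ring.
move=> [x0|<-]; last exact: S0.
rewrite -S0; symmetry; apply: (eq_is_derive S) => // t _; exact: dS.
Qed.

Lemma gauss_ker_RInt_bound (x : R) : 0 <= RInt (gauss_ker x) 0 1 <= exp (- x ^ 2).
Proof.
have k0 t : 0 <= gauss_ker x t <= exp (- x ^ 2).
  have t0 := pow2_ge_0 t; have t1 := one_plus_sqr_gt0 t.
  rewrite /gauss_ker; split.
    by apply: Rlt_le; apply: Rdiv_lt_0_compat => //; apply: exp_pos.
  apply: (Rle_trans _ (exp (- (x ^ 2 * (1 + t ^ 2))))).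
    apply/Rle_div_l => //.
    by have := exp_pos (- (x ^ 2 * (1 + t ^ 2))); nra.
  have := Rmult_le_pos _ _ (pow2_ge_0 x) t0.
  set q := x ^ 2 * t ^ 2 => q0.
  have -> : - (x ^ 2 * (1 + t ^ 2)) = - x ^ 2 - q by rewrite /q; ring.
  case: (Req_dec q 0) => [->|q1]; first by rewrite Rminus_0_r; apply: Rle_refl.
  by apply: Rlt_le; apply: exp_increasing; lra.
have e : RInt (fun _ => exp (- x ^ 2)) 0 1 = exp (- x ^ 2).
  by rewrite RInt_const /scal /= /mult /=; ring.
split.
  apply: RInt_ge_0; [lra|exact: ex_RInt_gauss_ker|by move=> t _; case: (k0 t)].
rewrite -[X in _ <= X]e; apply: RInt_le; [lra|exact: ex_RInt_gauss_ker|exact: ex_RInt_const|].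
by move=> t _; case: (k0 t).
Qed.

(** For x > 0 [gauss_int x] is nonnegative, so by [gauss_int_sqr] it is the square root of PI/4
    minus a kernel integral that is squeezed to 0. *)
Lemma gauss_int_infty : filterlim gauss_int (Rbar_locally p_infty) (locally (sqrt PI / 2)).
Proof.
have hexp : is_lim (fun x => exp (- x ^ 2)) p_infty 0.
  apply: (is_lim_comp exp _ p_infty 0 m_infty).
  - exact: is_lim_exp_m.
  - apply: (is_lim_ext (fun x => - (x * x))); first by move=> x; ring.
    have -> : m_infty = Rbar_opp (Rbar_mult p_infty p_infty) by [].
    by apply: is_lim_opp; apply: is_lim_mult => //; apply: is_lim_id.
  - by exists 0.
have hK : is_lim (fun x => RInt (gauss_ker x) 0 1) p_infty 0.
  apply: (is_lim_le_le_loc (fun _ => 0) (fun x => exp (- x ^ 2))) => //; last exact: is_lim_const.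
  by exists 0 => x _; apply: gauss_ker_RInt_bound.
have h : is_lim (fun x => sqrt (PI / 4 - RInt (gauss_ker x) 0 1)) p_infty (sqrt (PI / 4 - 0)).
  apply: (filterlim_comp _ _ _ _ sqrt _ (locally (PI / 4 - 0))); last exact: continuous_sqrt.
  by apply: (is_lim_minus' _ _ _ (PI / 4) 0) => //; apply: is_lim_const.
have -> : sqrt PI / 2 = sqrt (PI / 4 - 0).
  have := PI_RGT_0 => p0.
  rewrite Rminus_0_r sqrt_div_alt; last lra.
  have -> : 4 = 2 ^ 2 by ring.
  by rewrite sqrt_pow2; lra.
apply: filterlim_ext_loc h.
exists 0 => x x0.
rewrite -(gauss_int_sqr x); last lra.
have -> : gauss_int x ^ 2 + RInt (gauss_ker x) 0 1 - RInt (gauss_ker x) 0 1 = gauss_int x ^ 2 by ring.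
rewrite sqrt_pow2 //.
apply: RInt_ge_0; [lra|exact: ex_RInt_gauss|by move=> t _; apply: Rlt_le; apply: exp_pos].
Qed.

(** The substitution x = v^2 enters as the antiderivative 2 [gauss_int] (sqrt x). It is continuous
    at 0, so the singularity of the integrand there does no harm. *)
Lemma is_Gamma_half : is_Gamma (1 / 2) (sqrt PI).
Proof.
rewrite /is_Gamma.
have -> : sqrt PI = 2 * (sqrt PI / 2) - 2 * gauss_int (sqrt 0).
  rewrite sqrt_0 /gauss_int RInt_point /zero /=; field.
apply: (is_RInt_gen_antiderivative (fun x => 2 * gauss_int (sqrt x))).
- move=> x x0.
  have s0 := sqrt_lt_R0 x x0.
  have -> : Rpower x (1 / 2 - 1) * exp (- x) = 2 * (/ (2 * sqrt x) * exp (- sqrt x ^ 2)).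
    have -> : 1 / 2 - 1 = - / 2 by field.
    rewrite Rpower_Ropp Rpower_sqrt // pow2_sqrt; last lra.
    by field; lra.
  apply: is_derive_scal.
  apply: (is_derive_comp gauss_int sqrt); first exact: is_derive_gauss_int.
  by auto_derive => //; field; lra.
- by move=> x; apply: continuous_Gamma_integrand.
- apply: (filterlim_filter_le_1 (F := locally 0)); first exact: filter_le_within.
  apply: (filterlim_comp _ _ _ (fun x => gauss_int (sqrt x)) (Rmult 2) _
     (locally (gauss_int (sqrt 0)))); last exact: (filterlim_scal_r (K := R_AbsRing)).
  apply: (filterlim_comp _ _ _ sqrt gauss_int _ (locally (sqrt 0))); first exact: continuous_sqrt.
  by apply: ex_derive_continuous; eexists; apply: is_derive_gauss_int.
- apply: (filterlim_comp _ _ _ (fun x => gauss_int (sqrt x)) (Rmult 2) _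
     (locally (sqrt PI / 2))); last exact: (filterlim_scal_r (K := R_AbsRing)).
  apply: (filterlim_comp _ _ _ sqrt gauss_int _ (Rbar_locally p_infty)); last exact: gauss_int_infty.
  exact: filterlim_sqrt_p.
Qed.

(** The argument n/2 moves by 1 when n moves by 2, so the induction carries two neighbours, starting
    from Gamma(1/2) and Gamma(1). Sharing [l] keeps the recurrence at hand. *)
Lemma is_Gamma_half_integer (n : nat) :
  exists l, 0 < l /\ is_Gamma (INR n.+1 / 2) l /\ is_Gamma (INR n.+3 / 2) (INR n.+1 / 2 * l).
Proof.
have step m l : 0 < l -> is_Gamma (INR m.+1 / 2) l -> is_Gamma (INR m.+3 / 2) (INR m.+1 / 2 * l).
  move=> l0 hl.
  have -> : INR m.+3 / 2 = INR m.+1 / 2 + 1 by rewrite !S_INR; field.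
  apply: is_Gamma_succ => //; have := pos_INR m; rewrite S_INR; lra.
suff h m : (exists l, 0 < l /\ is_Gamma (INR m.+1 / 2) l) /\
           (exists l, 0 < l /\ is_Gamma (INR m.+2 / 2) l).
  by have [[l [l0 hl]] _] := h n; exists l; split=> //; split=> //; apply: step.
elim: m => [|m [[l [l0 hl]] h2]]; split=> //.
- exists (sqrt PI); split; first by apply: sqrt_lt_R0; apply: PI_RGT_0.
  exact: is_Gamma_half.
- exists 1; split; first lra.
  have -> : INR 2 / 2 = 1 by rewrite /=; field.
  exact: is_Gamma_1.
- exists (INR m.+1 / 2 * l); split; last exact: step.
  by apply: Rmult_lt_0_compat => //; have := pos_INR m; rewrite S_INR; lra.
Qed.

(** * The reciprocal Gamma function at half-integers of either sign *)

Lemma rGamma_pos (s : R) : 0 < s -> rGamma s = / Gamma s.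
Proof.
move=> s0; rewrite /rGamma.
have -> : Z.to_nat (up (- s)) = 0%N.
  have [_ h] := archimed (- s).
  have h1 : (up (- s) < 1)%Z by apply: lt_IZR; lra.
  lia.
by rewrite /= Rplus_0_r /Rdiv Rmult_1_l.
Qed.

Lemma poch_succ_l (s : R) (n : nat) : poch s n.+1 = s * poch (s + 1) n.
Proof.
elim: n s => [|n ih] s; first by rewrite /=; ring.
have -> : poch s n.+2 = poch s n.+1 * (s + INR n.+1) by [].
have -> : poch (s + 1) n.+1 = poch (s + 1) n * (s + 1 + INR n) by [].
by rewrite ih S_INR; ring.
Qed.

(** Purely formal: raising s by 1 lowers the shift n in [rGamma] by 1, so both sides evaluate
    [Gamma] at the same point. *)
Lemma rGamma_succ_npos (s : R) : s <= 0 -> rGamma s = s * rGamma (s + 1).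
Proof.
move=> s0; rewrite /rGamma.
have [h1 h2] := archimed (- s).
have [h3 h4] := archimed (- (s + 1)).
have e : up (- s) = (up (- (s + 1)) + 1)%Z.
  have a1 : (up (- s) < up (- (s + 1)) + 2)%Z by apply: lt_IZR; rewrite plus_IZR; lra.
  have a2 : (up (- (s + 1)) < up (- s))%Z by apply: lt_IZR; lra.
  lia.
have p : (0 <= up (- (s + 1)))%Z.
  have : (0 < up (- s))%Z by apply: lt_IZR; lra.
  lia.
have -> : Z.to_nat (up (- s)) = (Z.to_nat (up (- (s + 1)))).+1 by lia.
rewrite poch_succ_l S_INR.
set k := Z.to_nat _.
have -> : s + (INR k + 1) = s + 1 + INR k by ring.
by rewrite /Rdiv Rmult_assoc.
Qed.

(** Negative [z] matters because N applications of the operator carry the arguments of the first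
    terms below 0. *)
Lemma rGamma_half_succ (z : Z) : rGamma (IZR z / 2) = IZR z / 2 * rGamma (IZR z / 2 + 1).
Proof.
case: (Z_le_gt_dec z 0) => hz.
  by apply: rGamma_succ_npos; have := IZR_le _ _ hz; lra.
have [n ->] : exists n, z = Z.of_nat n.+1 by exists (Z.to_nat (z - 1)); lia.
rewrite -INR_IZR_INZ.
have n0 : 0 < INR n.+1 by rewrite S_INR; have := pos_INR n; lra.
rewrite !rGamma_pos; [|lra|lra].
have [l [l0 [h1 h2]]] := is_Gamma_half_integer n.
have -> : INR n.+1 / 2 + 1 = INR n.+3 / 2 by rewrite !S_INR; field.
rewrite (is_Gamma_unique _ _ h1) (is_Gamma_unique _ _ h2).
by field; lra.
Qed.

Lemma rGamma_half_poch (z : Z) (n : nat) :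
  rGamma (IZR z / 2) = poch (IZR z / 2) n * rGamma (IZR z / 2 + INR n).
Proof.
elim: n z => [|n ih] z; first by rewrite /= Rplus_0_r; ring.
rewrite poch_succ_l rGamma_half_succ.
have e : IZR z / 2 + 1 = IZR (z + 2) / 2 by rewrite plus_IZR; field.
rewrite e ih S_INR -e.
have -> : IZR z / 2 + 1 + INR n = IZR z / 2 + (INR n + 1) by ring.
by ring.
Qed.

Definition rGamma_half (n : nat) : R := rGamma (INR n / 2).

Lemma rGamma_half0 : rGamma_half 0 = 0.
Proof. by rewrite /rGamma_half rGamma_succ_npos /=; [field|lra]. Qed.

Lemma rGamma_half1 : rGamma_half 1 = / sqrt PI.
Proof.
rewrite /rGamma_half rGamma_pos /=; last lra.
by rewrite (is_Gamma_unique _ _ is_Gamma_half).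
Qed.

Lemma rGamma_half2 : rGamma_half 2 = 1.
Proof.
rewrite /rGamma_half rGamma_pos /=; last lra.
have -> : (1 + 1) / 2 = 1 by field.
by rewrite (is_Gamma_unique _ _ is_Gamma_1) Rinv_1.
Qed.

Lemma rGamma_half_step (n : nat) : rGamma_half n = INR n / 2 * rGamma_half n.+2.
Proof.
rewrite /rGamma_half [in LHS]INR_IZR_INZ rGamma_half_succ -INR_IZR_INZ.
by have -> : INR n / 2 + 1 = INR n.+2 / 2 by rewrite !S_INR; field.
Qed.

Lemma Gamma_half_gt0 (n : nat) : 0 < Gamma (INR n.+1 / 2).
Proof. by have [l [l0 [h _]]] := is_Gamma_half_integer n; rewrite (is_Gamma_unique _ _ h). Qed.

Lemma rGamma_half_gt0 (n : nat) : 0 < rGamma_half n.+1.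
Proof.
have n0 : 0 < INR n.+1 by rewrite S_INR; have := pos_INR n; lra.
rewrite /rGamma_half rGamma_pos; last lra.
by apply: Rinv_0_lt_compat; apply: Gamma_half_gt0.
Qed.

Lemma rGamma_half_ge0 (n : nat) : 0 <= rGamma_half n.
Proof.
case: n => [|n]; first by rewrite rGamma_half0; lra.
by apply: Rlt_le; apply: rGamma_half_gt0.
Qed.

(* Legendre's duplication formula at half-integers. *)
Lemma rGamma_half_duplication (n : nat) :
  sqrt PI * rGamma_half n.+1 * rGamma_half n.+2 = 2 ^ n * rGamma (INR n.+1).
Proof.
have p0 : 0 < sqrt PI by apply: sqrt_lt_R0; apply: PI_RGT_0.
have e m : rGamma (INR m.+1) = rGamma_half (2 * m.+1).
  by rewrite /rGamma_half mult_INR; congr rGamma; rewrite [INR 2]/=; field.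
elim: n => [|n ih].
  have -> : rGamma (INR 1) = 1 by rewrite e rGamma_half2.
  by rewrite rGamma_half1 rGamma_half2 /=; field; lra.
have n0 : 0 < INR n.+1 by rewrite S_INR; have := pos_INR n; lra.
move: ih; rewrite (rGamma_half_step n.+1) !e.
have -> : (2 * n.+2 = (2 * n.+1).+2)%N by lia.
rewrite (rGamma_half_step (2 * n.+1)) mult_INR [INR 2]/= => ih.
apply: (Rmult_eq_reg_l (INR n.+1 / 2)); last lra.
rewrite [2 ^ n.+1]/=.
transitivity (sqrt PI * (INR n.+1 / 2 * rGamma_half n.+3) * rGamma_half n.+2); first ring.
by rewrite ih; field.
Qed.

Lemma bounded_prefix (u : nat -> R) (m : nat) :
  exists M, 0 <= M /\ forall n, (n <= m)%N -> u n <= M.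
Proof.
elim: m => [|m [M [M0 hM]]].
  exists (Rmax 0 (u 0%N)); split; first exact: Rmax_l.
  by case=> // _; apply: Rmax_r.
exists (Rmax M (u m.+1)); split; first exact: Rle_trans M0 (Rmax_l _ _).
move=> n; rewrite leq_eqVlt => /orP [/eqP ->|h]; first exact: Rmax_r.
exact: Rle_trans (hM n h) (Rmax_l _ _).
Qed.

(* Beyond [n >= 2 x^2] the sequence decreases along each parity class. *)
Lemma rGamma_half_bounded (x : R) : 0 <= x ->
  exists M, forall n, 0 <= x ^ n * rGamma_half n <= M.
Proof.
move=> x0.
have [m hm] := nfloor_ex (2 * x ^ 2) (Rmult_le_pos _ _ (Rlt_le _ _ Rlt_0_2) (pow2_ge_0 x)).
have [M [M0 hM]] := bounded_prefix (fun n => x ^ n * rGamma_half n) m.+2.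
have pos n : 0 <= x ^ n * rGamma_half n.
  by apply: Rmult_le_pos; [apply: pow_le|apply: rGamma_half_ge0].
exists M; suff h n : x ^ n * rGamma_half n <= M /\ x ^ n.+1 * rGamma_half n.+1 <= M.
  by move=> n; split; [exact: pos|case: (h n)].
elim: n => [|n [ih1 ih2]]; first by split; apply: hM.
split=> //.
case: (leqP n.+2 m.+2) => hn; first exact: hM.
apply: Rle_trans ih1.
have hn' : INR m.+1 <= INR n by apply: le_INR; lia.
have n0 : 2 * x ^ 2 <= INR n by move: hn'; rewrite S_INR; lra.
have -> : x ^ n.+2 = x ^ n * x ^ 2 by rewrite /=; ring.
rewrite (rGamma_half_step n).
rewrite Rmult_assoc; apply: Rmult_le_compat_l; first exact: pow_le.
apply: Rmult_le_compat_r; first exact: rGamma_half_ge0.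
lra.
Qed.

(** * Entire series in the Lorentzian interval *)

HB.instance Definition _ := Monoid.isComLaw.Build R 0 Rplus
  (fun x y z => esym (Rplus_assoc x y z)) Rplus_comm Rplus_0_l.

(** Bounded terms at every radius amount to an infinite radius of convergence, and are what products
    and the bounds on 1/Gamma deliver directly. *)
Definition entire (a : nat -> R) : Prop :=
  forall r, exists M, forall n, Rabs (a n * r ^ n) <= M.

(** The Euler operator p x d/dx + q, read on the coefficients of a power series. *)
Definition affine (p q : R) (a : nat -> R) (k : nat) : R := (INR k * p + q) * a k.

Lemma entire_CV_radius (a : nat -> R) : entire a -> CV_radius a = p_infty.
Proof.
move=> ha; have [ub _] := CV_radius_bounded a.
move: ub; case: (CV_radius a) => [l| |] // ub; exfalso.
- by have := ub _ (ha (l + 1)); rewrite /=; lra.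
- exact: (ub _ (ha 0)).
Qed.

Lemma entire_ex_pseries (a : nat -> R) (x : R) : entire a -> ex_pseries a x.
Proof. by move=> ha; apply: CV_radius_inside; rewrite entire_CV_radius. Qed.

Lemma INR_succ_le_pow2 (n : nat) : INR n + 1 <= 2 ^ n.
Proof. by elim: n => [|n ih]; [rewrite /=; lra|rewrite S_INR /=; have := pos_INR n; lra]. Qed.

(** Doubling the radius frees a factor 2^n, which absorbs the linear growth of the multiplier. *)
Lemma entire_affine (p q : R) (a : nat -> R) : entire a -> entire (affine p q a).
Proof.
move=> ha r; have [M hM] := ha (2 * r).
exists ((Rabs p + Rabs q) * M) => n.
have hn := INR_succ_le_pow2 n; have n0 := pos_INR n.
have h2 : 0 < 2 ^ n by apply: pow_lt; lra.
have := hM n; rewrite Rpow_mult_distr !Rabs_mult (Rabs_pos_eq (2 ^ n)); last lra.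
move=> {}hM; rewrite /affine.
have hp := Rabs_pos p; have hq := Rabs_pos q.
have h1 : Rabs (INR n * p + q) <= (Rabs p + Rabs q) * 2 ^ n.
  apply: Rle_trans (Rabs_triang _ _) _.
  rewrite Rabs_mult (Rabs_pos_eq (INR n)) //.
  nra.
apply: (Rle_trans _ ((Rabs p + Rabs q) * (Rabs (a n) * (2 ^ n * Rabs (r ^ n))))).
  have -> : (Rabs p + Rabs q) * (Rabs (a n) * (2 ^ n * Rabs (r ^ n))) =
    ((Rabs p + Rabs q) * 2 ^ n) * (Rabs (a n) * Rabs (r ^ n)) by ring.
  rewrite Rmult_assoc; apply: Rmult_le_compat_r h1.
  by apply: Rmult_le_pos; apply: Rabs_pos.
by apply: Rmult_le_compat_l; lra.
Qed.

Lemma PSeries_affine (p q : R) (a : nat -> R) (x : R) : entire a ->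
  PSeries (affine p q a) x = p * (x * PSeries (PS_derive a) x) + q * PSeries a x.
Proof.
move=> ha.
have e1 : ex_pseries (PS_derive a) x by apply: ex_pseries_derive; rewrite entire_CV_radius.
have e0 := entire_ex_pseries a x ha.
rewrite -PSeries_incr_1 -!PSeries_scal -PSeries_plus; first last.
- by apply: ex_pseries_scal e0; rewrite /mult /= Rmult_comm.
- by apply: ex_pseries_scal; [rewrite /mult /= Rmult_comm|exact: ex_pseries_incr_1].
apply: PSeries_ext => -[|n];
  rewrite /affine /PS_plus /PS_scal /PS_incr_1 /PS_derive /plus /scal /mult /zero /= /mult /=; ring.
Qed.

(* [sum_k a_k w^((kN - m)/2)]; the index [N] keeps half-integer powers of [w] inside a power
   series without padding its coefficients with zeros. *)
Definition radial (N : nat) (a : nat -> R) (m : nat) (w : R) : R :=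
  PSeries a (sqrt w ^ N) / sqrt w ^ m.

(** Trades the truncated exponent of the power rule for a division; at n = 0 both sides vanish. *)
Lemma pow_pred_mul (n : nat) (r : R) : r <> 0 -> INR n * r ^ n.-1 = INR n * (r ^ n / r).
Proof. by move=> r0; case: n => [|n] /=; field. Qed.

Lemma is_derive_eq (f : R -> R) (x l l' : R) : is_derive f x l -> l = l' -> is_derive f x l'.
Proof. by move=> h <-. Qed.

(** Termwise, w^((kN - m)/2) gains the factor (kN - m)/2 and loses one power of w, which raises [m]
    by 2. *)
Lemma is_derive_radial (N : nat) (a : nat -> R) (m : nat) (w : R) : entire a -> 0 < w ->
  is_derive (radial N a m) w (radial N (affine (INR N / 2) (- (INR m / 2)) a) m.+2 w).
Proof.
move=> ha w0; have r0 := sqrt_lt_R0 w w0.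
have dr : is_derive sqrt w (/ (2 * sqrt w)) by auto_derive => //; field; lra.
have dp n : is_derive (fun w => sqrt w ^ n) w (INR n * (sqrt w ^ n / sqrt w) / (2 * sqrt w)).
  apply: is_derive_eq (is_derive_pow sqrt n w _ dr) _.
  rewrite -pow_pred_mul; last lra.
  by rewrite /Rdiv; ring.
have hr : Rbar_lt (Rabs (sqrt w ^ N)) (CV_radius a) by rewrite entire_CV_radius.
have dP := is_derive_comp (PSeries a) _ w _ _ (is_derive_PSeries a _ hr) (dp N).
have rm : sqrt w ^ m <> 0 by apply: pow_nonzero; lra.
apply: is_derive_eq (is_derive_div _ _ w _ _ dP (dp m) rm) _.
rewrite /radial PSeries_affine // /scal /= /mult /=.
by field; split; lra.
Qed.

(** * Partial derivatives, smoothness and the wave operator inside the cone *)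

Definition interval_sq {d : nat} (c : R) (y : 'I_d -> R) (t : R) : R :=
  c ^ 2 * t ^ 2 - vnorm y ^ 2.

Section Cone.
Variables (d : nat) (c : R) (c0 : 0 < c).

Implicit Types (y : 'I_d -> R) (t : R) (o : option 'I_d) (u v : ('I_d -> R) -> R -> R).

Lemma vnorm_sqr y : vnorm y ^ 2 = \big[Rplus/0]_(j < d) (y j * y j).
Proof.
rewrite /vnorm pow2_sqrt //.
by apply: (big_ind (fun x => 0 <= x)); [lra|move=> *; lra|move=> j _; nra].
Qed.

Lemma vnorm_upd y j s :
  vnorm (upd y j s) ^ 2 = s ^ 2 + \big[Rplus/0]_(i < d | i != j) (y i * y i).
Proof.
rewrite vnorm_sqr (bigD1 j) //=; congr (_ + _).
  by rewrite /upd eqxx; ring.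
by apply: eq_bigr => i /negbTE ij; rewrite /upd ij.
Qed.

Lemma upd_id y j : upd y j (y j) = y.
Proof.
by apply: functional_extensionality => i; rewrite /upd; case: eqP => // ->.
Qed.

Lemma slice_coord o u y t : slice o u y t (coord o y t) = u y t.
Proof. by case: o => [j|] //=; rewrite upd_id. Qed.

Lemma coneE y t : cone c y t <-> 0 < t /\ 0 < interval_sq c y t.
Proof.
have n0 : 0 <= vnorm y by apply: sqrt_pos.
rewrite /cone /interval_sq; split=> -[t0 h]; split=> //.
  by have := Rmult_lt_0_compat _ _ c0 t0; nra.
by apply: Rnot_le_lt => h'; have := Rmult_lt_0_compat _ _ c0 t0; nra.
Qed.

(* Half of the partial derivative of [interval_sq]. *)
Definition half_grad o y t : R := match o with None => c ^ 2 * t | Some j => - y j end.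

Lemma is_derive_interval_sq o y t :
  is_derive (slice o (interval_sq c) y t) (coord o y t) (2 * half_grad o y t).
Proof.
case: o => [j|] /=; rewrite /interval_sq.
  apply: (is_derive_ext (fun s => c ^ 2 * t ^ 2 -
      (s ^ 2 + \big[Rplus/0]_(i < d | i != j) (y i * y i)))).
    by move=> s; rewrite vnorm_upd.
  by auto_derive => //; ring.
by auto_derive => //; ring.
Qed.

(** Openness of the cone along a coordinate line, from continuity of [interval_sq]. It lets
    identities valid only on the cone pass through [Derive]. *)
Lemma locally_cone o y t (P : R -> Prop) : cone c y t ->
  (forall y' t', cone c y' t' -> forall s, 
     match o with Some j => y' = upd y j s /\ t' = t | None => y' = y /\ t' = s end -> P s) ->
  locally (coord o y t) P.
Proof.
move=> /coneE [t0 w0] h.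
have cw : continuous (slice o (interval_sq c) y t) (coord o y t).
  by apply: ex_derive_continuous; eexists; apply: is_derive_interval_sq.
have lw : locally (coord o y t) (fun s => 0 < slice o (interval_sq c) y t s).
  by apply: (cw (fun x => 0 < x)); apply: (open_gt 0); rewrite slice_coord.
have lt : locally (coord o y t) (fun s => 0 < (if o is Some _ then t else s)).
  case: o h cw lw => [j|] _ _ _; first by apply: filter_forall.
  exact: (open_gt 0).
apply: filter_imp (filter_and _ _ lw lt) => s [].
case: o h cw lw lt => [j|] h _ _ _ /= h1 h2.
  by apply: (h (upd y j s) t) => //; apply/coneE.
by apply: (h y s) => //; apply/coneE.
Qed.

Lemma slice_eq_locally o u v y t :
  (forall y t, cone c y t -> u y t = v y t) -> cone c y t ->
  locally (coord o y t) (fun s => slice o u y t s = slice o v y t s).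
Proof.
move=> e h; apply: locally_cone => // y' t' h' s.
by case: o => [j|] [h1 h2] /=; subst; apply: e.
Qed.

Lemma pd_ext o u v : (forall y t, cone c y t -> u y t = v y t) ->
  forall y t, cone c y t -> pd o u y t = pd o v y t.
Proof. by move=> e y t h; apply: Derive_ext_loc; apply: slice_eq_locally. Qed.

Lemma KG_ext u v : (forall y t, cone c y t -> u y t = v y t) ->
  forall y t, cone c y t -> KG c u y t = KG c v y t.
Proof.
move=> e y t h; rewrite /KG; congr (_ - _ * _).
  by do 2!apply: pd_ext => // ? ? ?.
by apply: eq_bigr => j _; do 2!apply: pd_ext => // ? ? ?.
Qed.

Lemma is_derive_radial_cone o (N : nat) (a : nat -> R) (m : nat) y t : entire a -> cone c y t ->
  is_derive (slice o (fun y t => radial N a m (interval_sq c y t)) y t) (coord o y t)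
    (2 * half_grad o y t
     * radial N (affine (INR N / 2) (- (INR m / 2)) a) m.+2 (interval_sq c y t)).
Proof.
move=> ha /coneE [t0 w0].
apply: (is_derive_ext (fun s => radial N a m (slice o (interval_sq c) y t s))).
  by case: o.
apply: (is_derive_comp (radial N a m)); last exact: is_derive_interval_sq.
by rewrite slice_coord; apply: is_derive_radial.
Qed.

(* An algebra stable under all partial derivatives, which gives smoothness. *)
Inductive cone_class (N : nat) : (('I_d -> R) -> R -> R) -> Prop :=
| cone_class_const x : cone_class N (fun _ _ => x)
| cone_class_coord o : cone_class N (coord o)
| cone_class_radial a m : entire a ->
    cone_class N (fun y t => radial N a m (interval_sq c y t))
| cone_class_plus u v : cone_class N u -> cone_class N v ->
    cone_class N (fun y t => u y t + v y t)
| cone_class_mult u v : cone_class N u -> cone_class N v ->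
    cone_class N (fun y t => u y t * v y t).

Lemma cone_class_half_grad N o : cone_class N (half_grad o).
Proof.
case: o => [j|].
  have -> : half_grad (Some j) = fun y t => (- 1) * coord (Some j) y t.
    by do 2!apply: functional_extensionality => ?; rewrite /=; ring.
  by apply: cone_class_mult; [exact: cone_class_const|exact: cone_class_coord].
apply: (cone_class_mult N (fun _ _ => c ^ 2) (coord None)); first exact: cone_class_const.
exact: cone_class_coord.
Qed.

Lemma cone_class_derive N o u : cone_class N u -> exists u', cone_class N u' /\
  forall y t, cone c y t -> is_derive (slice o u y t) (coord o y t) (u' y t).
Proof.
elim=> {u} [x|o'|a m ha|u v _ [u' [cu du]] _ [v' [cv dv]]|u v hu [u' [cu du]] hv [v' [cv dv]]].
- exists (fun _ _ => 0); split; first exact: cone_class_const.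
  by move=> y t _; case: o => [j|]; apply: is_derive_const.
- exists (fun _ _ => if o == o' then 1 else 0); split; first exact: cone_class_const.
  move=> y t _; case: o o' => [j|] [i|] /=; try exact: is_derive_const; last exact: is_derive_id.
  have -> : (Some j == Some i) = (j == i) by [].
  rewrite /upd; case: (eqVneq j i) => _; first exact: is_derive_id.
  exact: is_derive_const.
- exists (fun y t => 2 * half_grad o y t
     * radial N (affine (INR N / 2) (- (INR m / 2)) a) m.+2 (interval_sq c y t)); split.
    apply: (cone_class_mult N (fun y t => 2 * half_grad o y t)).
      apply: (cone_class_mult N (fun _ _ => 2)); first exact: cone_class_const.
      exact: cone_class_half_grad.
    by apply: cone_class_radial; apply: entire_affine.
  by move=> y t; apply: is_derive_radial_cone.
- exists (fun y t => u' y t + v' y t); split; first exact: cone_class_plus.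
  move=> y t h.
  apply: (is_derive_ext (fun s => slice o u y t s + slice o v y t s)); first by case: o {du dv}.
  exact: (is_derive_plus _ _ _ _ _ (du y t h) (dv y t h)).
- exists (fun y t => u' y t * v y t + u y t * v' y t); split.
    by apply: cone_class_plus; apply: cone_class_mult.
  move=> y t h.
  apply: (is_derive_ext (fun s => slice o u y t s * slice o v y t s)); first by case: o {du dv}.
  rewrite -(slice_coord o u) -(slice_coord o v).
  exact: (is_derive_mult _ _ _ _ _ (du y t h) (dv y t h) Rmult_comm).
Qed.

(** Since the cone is open along coordinate lines, every iterated partial derivative of [u] agrees
    there with a member of the class, and members are differentiable. *)
Lemma cone_class_smooth N u v : cone_class N v ->
  (forall y t, cone c y t -> u y t = v y t) -> smooth_on (@cone d c) u.
Proof.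
move=> hv e l.
suff [v' [hv' e']] : exists v', cone_class N v' /\
    forall y t, cone c y t -> pdl l u y t = v' y t.
  move=> o y t h; have [w [_ dw]] := cone_class_derive N o v' hv'.
  exists (w y t); apply: (is_derive_ext_loc (slice o v' y t)); last exact: dw.
  by apply: slice_eq_locally => // ? ? ?; symmetry; apply: e'.
elim: l => [|o l [v' [hv' e']]]; first by exists v.
have [w [hw dw]] := cone_class_derive N o v' hv'.
exists w; split=> // y t h.
rewrite /= (pd_ext _ _ _ e') //.
by apply: is_derive_unique; apply: dw.
Qed.

Lemma pd_pd_radial o (N : nat) (a : nat -> R) (m : nat) y t : entire a -> cone c y t ->
  let a1 := affine (INR N / 2) (- (INR m / 2)) a in
  let a2 := affine (INR N / 2) (- (INR m.+2 / 2)) a1 in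
  pd o (pd o (fun y t => radial N a m (interval_sq c y t))) y t =
  2 * (if o is None then c ^ 2 else - 1) * radial N a1 m.+2 (interval_sq c y t)
  + 4 * half_grad o y t ^ 2 * radial N a2 m.+4 (interval_sq c y t).
Proof.
move=> ha h a1 a2.
have ha1 : entire a1 by apply: entire_affine.
rewrite (pd_ext _ _ (fun y t => 2 * half_grad o y t * radial N a1 m.+2 (interval_sq c y t))) //;
  last by move=> y' t' h'; apply: is_derive_unique; apply: is_derive_radial_cone.
apply: is_derive_unique.
have dq : is_derive (fun s => 2 * slice o (half_grad o) y t s) (coord o y t)
    (2 * (if o is None then c ^ 2 else - 1)).
  case: o => [j|] /=; last by auto_derive => //; ring.
  apply: (is_derive_ext (fun s => 2 * - s)); first by move=> s; rewrite /upd eqxx.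
  by auto_derive => //; ring.
have dr := is_derive_radial_cone o N a1 m.+2 y t ha1 h.
have := is_derive_mult _ _ _ _ _ dq dr Rmult_comm.
rewrite !slice_coord => hd.
have -> : 4 * half_grad o y t ^ 2 * radial N a2 m.+4 (interval_sq c y t)
  = 2 * half_grad o y t * (2 * half_grad o y t * radial N a2 m.+4 (interval_sq c y t)) by ring.
by case: o {dq dr} hd.
Qed.

Lemma sum_affine_ord (n : nat) (x : 'I_n -> R) (p q : R) :
  \big[Rplus/0]_(j < n) (p + q * x j) = INR n * p + q * \big[Rplus/0]_(j < n) x j.
Proof.
elim: n x => [|n ih] x; first by rewrite !big_ord0 /=; ring.
by rewrite !big_ord_recl ih S_INR; ring.
Qed.

(** For w = [interval_sq] the wave operator gives 2 c^2 (1 + d), and w_t^2 - c^2 |grad w|^2 = 4 c^2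
    w. A function phi(w) is thus sent to 2 c^2 (1 + d) phi' + 4 c^2 w phi''. On w^b with b = (kN -
    m)/2 the factor beyond b is 2 c^2 (1 + d) + 4 c^2 (b - 1), the outer [affine] multiplier. *)
Lemma KG_radial (N : nat) (a : nat -> R) (m : nat) y t : entire a -> cone c y t ->
  KG c (fun y t => radial N a m (interval_sq c y t)) y t =
  radial N (affine (2 * c ^ 2 * INR N) (2 * c ^ 2 * (INR d - 1 - INR m))
    (affine (INR N / 2) (- (INR m / 2)) a)) m.+2 (interval_sq c y t).
Proof.
move=> ha h; rewrite /KG pd_pd_radial //.
have ha1 : entire (affine (INR N / 2) (- (INR m / 2)) a) by apply: entire_affine.
move: ha1; set a1 := affine _ _ a => ha1.
set a2 := affine _ _ a1.
have /coneE [t0 w0] := h.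
set W := interval_sq c y t; rewrite -/W in w0.
have -> : \big[Rplus/0]_(j < d) pd (Some j) (pd (Some j)
    (fun y t => radial N a m (interval_sq c y t))) y t
  = \big[Rplus/0]_(j < d) (- 2 * radial N a1 m.+2 W + 4 * radial N a2 m.+4 W * (y j * y j)).
  by apply: eq_bigr => j _; rewrite pd_pd_radial //= -/a1 -/a2 -/W; ring.
rewrite sum_affine_ord -vnorm_sqr.
(* The factor w in front of phi'' brings both terms to the same index [m.+2]. *)
have e : radial N a2 m.+2 W = W * radial N a2 m.+4 W.
  have r0 := sqrt_lt_R0 W w0.
  have sW : W = sqrt W * sqrt W by rewrite sqrt_sqrt; lra.
  rewrite /radial {3}sW /=.
  by field; split; [apply: pow_nonzero|]; lra.
have -> : vnorm y ^ 2 = c ^ 2 * t ^ 2 - W by rewrite /W /interval_sq; ring.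
transitivity (2 * c ^ 2 * (1 + INR d) * radial N a1 m.+2 W + 4 * c ^ 2 * radial N a2 m.+2 W).
  by rewrite e /half_grad; ring.
rewrite /radial !PSeries_affine // !S_INR.
have r0 := sqrt_lt_R0 W w0.
by field; apply: pow_nonzero; lra.
Qed.

End Cone.

(** * The random flight *)

Lemma Rpower_half (w : R) (n : nat) : 0 < w -> Rpower w (INR n / 2) = sqrt w ^ n.
Proof.
move=> w0; have r0 := sqrt_lt_R0 w w0.
by rewrite -Rpower_pow // -Rpower_sqrt // Rpower_mult; congr Rpower; field.
Qed.

Lemma pow_powE (x : R) (m n : nat) : (x ^ m) ^ n = x ^ (n * m)%N.
Proof. by rewrite -pow_mult Nat.mul_comm. Qed.

Lemma entire_rGamma_half (phi : nat -> nat) : (forall k, (k <= phi k)%N) ->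
  entire (fun k => rGamma_half (phi k)).
Proof.
move=> hphi r.
(* The maximum with 1 makes the powers of the radius nondecreasing, so R^k is at most R^(phi k). *)
have R1 := Rmax_l 1 (Rabs r); have Rr := Rmax_r 1 (Rabs r).
move: R1 Rr; set R := Rmax _ _ => R1 Rr.
have [M hM] := rGamma_half_bounded R (Rle_trans _ _ _ Rle_0_1 R1).
exists M => k; apply: Rle_trans (proj2 (hM (phi k))).
have h0 := rGamma_half_ge0 (phi k).
rewrite Rabs_mult (Rabs_pos_eq _ h0) Rmult_comm -RPow_abs.
apply: Rmult_le_compat_r => //.
apply: (Rle_trans _ (R ^ k)); first by apply: pow_incr; split=> //; apply: Rabs_pos.
by apply: Rle_pow => //; apply/leP.
Qed.

Definition flight_coef (N : nat) (rho : R) (k : nat) : R :=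
  rho ^ (k * N) * rGamma_half (k * N) * rGamma_half (k * N + N.+1).

Lemma flight_coef0 (N : nat) (rho : R) : flight_coef N rho 0 = 0.
Proof. by rewrite /flight_coef mul0n rGamma_half0; ring. Qed.

(** One reciprocal Gamma factor absorbs rho^(kN), the other absorbs r^k. *)
Lemma entire_flight_coef (N : nat) (rho : R) : (0 < N)%N -> 0 <= rho ->
  entire (flight_coef N rho).
Proof.
move=> N0 rho0 r.
have [M hM] := rGamma_half_bounded rho rho0.
have [M' hM'] := entire_rGamma_half (fun k => k * N + N.+1)%N ltac:(move=> k; nia) r.
exists (M * M') => k.
have [h0 h1] := hM (k * N)%N.
rewrite /flight_coef Rmult_assoc Rabs_mult (Rabs_pos_eq _ h0).
by apply: Rmult_le_compat => //; apply: Rabs_pos.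
Qed.

(** Allows the normalisation of [probN] to be cancelled: all terms are nonnegative and the first is
    positive. *)
Lemma ML2_gt0 (N : nat) (x : R) : (0 < N)%N -> 0 <= x -> 0 < ML2 (INR N) (INR N.+1) x.
Proof.
move=> N0 x0; rewrite /ML2.
pose g k := rGamma_half (2 * (N * k + N.+1)).
have eg k : x ^ k * rGamma (INR N * INR k + INR N.+1) = g k * x ^ k.
  rewrite Rmult_comm; congr (_ * _); rewrite /g /rGamma_half; congr rGamma.
  by rewrite mult_INR plus_INR mult_INR [INR 2]/=; field.
rewrite (Series_ext _ _ eg).
have exg : ex_series (fun k => g k * x ^ k).
  apply/ex_pseries_R; apply: entire_ex_pseries; apply: entire_rGamma_half => k; nia.
rewrite Series_incr_1 //.
have g0 : 0 < g 0%N.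
  rewrite /g; have -> : (2 * (N * 0 + N.+1) = (2 * N).+2)%N by lia.
  exact: rGamma_half_gt0.
have : 0 * Series (fun k => g k.+1 * x ^ k.+1) <= Series (fun k => g k.+1 * x ^ k.+1).
  rewrite -Series_scal_l; apply: Series_le; last by apply/(ex_series_incr_1 (fun k => g k * x ^ k)).
  move=> k; rewrite Rmult_0_l; split; first lra.
  by apply: Rmult_le_pos; [apply: rGamma_half_ge0|apply: pow_le].
by rewrite [x ^ 0]/=; lra.
Qed.

(** Duplication merges the two Gamma factors into 2^(kN + N) / (sqrt PI Gamma(kN + N + 1)), and
    halving [z] absorbs 2^(kN). Hence the prefactor of [fKG] cancels the denominator of [probN]. *)
Lemma MML_ML2 (N : nat) (z : R) :
  MML N.+2 ((z / 2) ^ N) = 2 ^ N / sqrt PI * ML2 (INR N) (INR N.+1) (z ^ N).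
Proof.
have p0 : 0 < sqrt PI by apply: sqrt_lt_R0; apply: PI_RGT_0.
rewrite /MML /ML2 -Series_scal_l; apply: Series_ext => k.
have -> : rGamma ((INR k + 1) * (INR N.+2 / 2 - 1) + 1) = rGamma_half (k * N + N).+2.
  by rewrite /rGamma_half; congr rGamma; rewrite !S_INR plus_INR mult_INR; field.
have -> : rGamma ((INR N.+2 - 1) / 2 + (INR N.+2 / 2 - 1) * INR k) = rGamma_half (k * N + N).+1.
  by rewrite /rGamma_half; congr rGamma; rewrite !S_INR plus_INR mult_INR; field.
have -> : INR N * INR k + INR N.+1 = INR (k * N + N).+1.
  by rewrite !S_INR plus_INR mult_INR; ring.
have h2 : (2 : R) ^ N <> 0 by apply: pow_nonzero; lra.
have -> : rGamma (INR (k * N + N).+1) = sqrt PI * rGamma_half (k * N + N).+1 *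
    rGamma_half (k * N + N).+2 / (2 ^ N) ^ k / 2 ^ N.
  rewrite rGamma_half_duplication pow_add pow_powE; field.
  by split=> //; apply: pow_nonzero; lra.
have -> : (z / 2) ^ N = z ^ N / 2 ^ N by rewrite /Rdiv Rpow_mult_distr pow_inv.
rewrite {1}/Rdiv Rpow_mult_distr pow_inv.
by field; split; [apply: pow_nonzero|]; lra.
Qed.

Section Flight.
Variables (N : nat) (c lam : R) (N0 : (0 < N)%N) (c0 : 0 < c) (lam0 : 0 < lam).

Implicit Types (y : 'I_N.+2 -> R) (t : R).

(** Duplication splits the reciprocal Gamma of [probN] into two half-integer factors; the numerator
    Gamma of [pcond] cancels one of them. *)
Lemma flight_term y t k : cone c y t ->
  Rpower PI (INR N.+2 / 2) * (c * t) ^ N * MML N.+2 ((lam * t / 2) ^ N)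
    * (pcond c y t k.+1 * probN N.+2 lam t k.+1) =
  flight_coef N (lam / (2 * c)) k.+1 * (sqrt (interval_sq c y t) ^ N) ^ k.+1
    / sqrt (interval_sq c y t) ^ 2.
Proof.
move=> /(coneE _ _ c0) [t0 w0].
have ct0 := Rmult_lt_0_compat _ _ c0 t0.
have lt0 := Rmult_lt_0_compat _ _ lam0 t0.
have p0 : 0 < sqrt PI by apply: sqrt_lt_R0; apply: PI_RGT_0.
rewrite MML_ML2 /pcond /probN -/(interval_sq c y t).
have -> : (N.+2 - 2 = N)%N by lia.
have -> : (N.+2 - 1 = N.+1)%N by lia.
have -> : (N * k.+1 + N.+2 - 1 = (k.+1 * N + N).+1)%N by lia.
have m0 : 0 < ML2 (INR N) (INR N.+1) ((lam * t) ^ N).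
  by apply: ML2_gt0 => //; apply: pow_le; lra.
move: m0; set ML := ML2 _ _ _ => m0.
set n := (k.+1 * N)%N.
have nE : INR n = (INR k + 1) * INR N by rewrite /n mult_INR S_INR.
have -> : (INR k.+1 + 1) * (INR N.+2 / 2 - 1) + 1 = INR (n + N).+2 / 2.
  by rewrite !S_INR plus_INR nE; field.
have -> : INR k.+1 * (INR N.+2 / 2 - 1) = INR n / 2 by rewrite !S_INR nE; field.
have -> : 2 * (INR k.+1 + 1) * (INR N.+2 / 2 - 1) = INR (n + N).
  by rewrite !S_INR plus_INR nE; field.
rewrite Rpower_pow // -/(rGamma_half n).
have g0 := rGamma_half_gt0 (n + N).+1.
have -> : Gamma (INR (n + N).+2 / 2) = / rGamma_half (n + N).+2.
  rewrite /rGamma_half rGamma_pos ?Rinv_inv // !S_INR.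
  by have := pos_INR (n + N); lra.
have -> : rGamma (INR (n + N).+1) = sqrt PI * rGamma_half (n + N).+1 *
    rGamma_half (n + N).+2 / (2 ^ n * 2 ^ N).
  rewrite rGamma_half_duplication pow_add; field.
  by split; apply: pow_nonzero; lra.
rewrite /Rminus Rpower_plus (Rpower_half (interval_sq c y t)) // Rpower_Ropp Rpower_1 //.
rewrite /flight_coef -/n addnS pow_powE -/n.
have r0 := sqrt_lt_R0 _ w0.
have -> : / interval_sq c y t = / sqrt (interval_sq c y t) ^ 2 by rewrite pow2_sqrt //; lra.
have pi0 : 0 < Rpower PI (INR N.+2 / 2) by apply: exp_pos.
have -> : (lam / (2 * c)) ^ n = lam ^ n / (2 ^ n * c ^ n).
  by rewrite /Rdiv Rpow_mult_distr pow_inv Rpow_mult_distr.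
rewrite !Rpow_mult_distr !pow_add.
have nz x m : 0 < x -> x ^ m <> 0 by move=> x0; apply: pow_nonzero; lra.
field; repeat split; try (apply: nz; lra); lra.
Qed.

(** The coefficient at k = 0 vanishes, so the sum from k = 1 is a full power series and f is a
    single [radial] function. *)
Lemma is_series_fKG y t : cone c y t ->
  fKG c lam y t = radial N (flight_coef N (lam / (2 * c))) 2 (interval_sq c y t) /\
  is_series (fun k => flight_coef N (lam / (2 * c)) k.+1 * (sqrt (interval_sq c y t) ^ N) ^ k.+1
    / sqrt (interval_sq c y t) ^ 2) (fKG c lam y t).
Proof.
move=> h.
set rho := lam / (2 * c).
have rho0 : 0 <= rho by apply: Rlt_le; apply: Rdiv_lt_0_compat; lra.
set x := sqrt (interval_sq c y t) ^ N.
have hs : is_series (fun k => flight_coef N rho k.+1 * x ^ k.+1 / sqrt (interval_sq c y t) ^ 2)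
    (radial N (flight_coef N rho) 2 (interval_sq c y t)).
  apply: (is_series_scal_r (/ _)).
  apply: (is_series_incr_1 (fun k => flight_coef N rho k * x ^ k)).
  rewrite flight_coef0 Rmult_0_l plus_zero_r.
  apply/is_pseries_R; apply: PSeries_correct; apply: entire_ex_pseries.
  exact: entire_flight_coef.
have e : fKG c lam y t = radial N (flight_coef N rho) 2 (interval_sq c y t).
  rewrite -(is_series_unique _ _ hs) /fKG /pY -Series_scal_l.
  apply: Series_ext => k; rewrite -flight_term //.
  by have -> : (N.+2 - 2 = N)%N by lia.
by rewrite e.
Qed.

(** * The iterated operator on coefficients and the resulting equation *)

Fixpoint KG_coef (j : nat) : nat -> R :=
  match j with
  | 0%N => flight_coef N (lam / (2 * c))
  | i.+1 => affine (2 * c ^ 2 * INR N) (2 * c ^ 2 * (INR N.+2 - 1 - INR (2 * i).+2))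
      (affine (INR N / 2) (- (INR (2 * i).+2 / 2)) (KG_coef i))
  end.

Lemma entire_KG_coef j : entire (KG_coef j).
Proof.
elim: j => [|j ih] /=; last by do 2!apply: entire_affine.
by apply: entire_flight_coef => //; apply: Rlt_le; apply: Rdiv_lt_0_compat; lra.
Qed.

(** [KG_coef] copies the multipliers of [KG_radial] at m = 2j + 2. The previous closed form holds
    only on the cone, hence the appeal to [KG_ext]. *)
Lemma iter_KG_fKG j y t : cone c y t ->
  Nat.iter j (KG c) (fKG c lam) y t = radial N (KG_coef j) (2 * j).+2 (interval_sq c y t).
Proof.
elim: j y t => [|j ih] y t h; first by case: (is_series_fKG y t h).
have -> : (2 * j.+1 = (2 * j).+2)%N by lia.
by rewrite [Nat.iter _ _ _]/= (KG_ext _ c c0 _ _ ih) // KG_radial //; apply: entire_KG_coef.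
Qed.

(** Step j contributes 4 c^2 (kN/2 - (j+1)) ((kN+N+1)/2 - (j+1)), because d - 1 = N + 1. Each new
    factor is the smallest so far, so it enters its Pochhammer product on the left. *)
Lemma KG_coef_poch (j k : nat) : KG_coef j k =
  (4 * c ^ 2) ^ j * poch (INR (k * N) / 2 - INR j) j
    * poch (INR (k * N + N.+1) / 2 - INR j) j * flight_coef N (lam / (2 * c)) k.
Proof.
elim: j => [|j ih]; first by rewrite /=; ring.
have -> : KG_coef j.+1 k = (INR k * (2 * c ^ 2 * INR N) +
   (2 * c ^ 2 * (INR N.+2 - 1 - INR (2 * j).+2))) *
   ((INR k * (INR N / 2) + - (INR (2 * j).+2 / 2)) * KG_coef j k) by [].
rewrite ih !poch_succ_l.
have e x : x - INR j.+1 + 1 = x - INR j by rewrite S_INR; ring.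
have -> : INR (2 * j).+2 = 2 * INR j + 2 by rewrite !S_INR mult_INR [INR 2]/=; ring.
have eN : INR N.+2 = INR N + 2 by rewrite !S_INR; ring.
rewrite !e eN plus_INR mult_INR !S_INR.
have -> : (4 * c ^ 2) ^ j.+1 = 4 * c ^ 2 * (4 * c ^ 2) ^ j by [].
by field.
Qed.

(** Each Pochhammer product lowers the argument of one reciprocal Gamma by N, also across 0, which
    is why the recurrence over [Z] is used. *)
Lemma KG_coef_rGamma (k : nat) : KG_coef N k =
  (4 * c ^ 2) ^ N * (lam / (2 * c)) ^ (k * N)
    * rGamma (INR (k * N) / 2 - INR N) * rGamma (INR (k * N + N.+1) / 2 - INR N).
Proof.
rewrite KG_coef_poch /flight_coef /rGamma_half.
have e m : rGamma (INR m / 2 - INR N) = poch (INR m / 2 - INR N) N * rGamma (INR m / 2).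
  have -> : INR m / 2 - INR N = IZR (Z.of_nat m - 2 * Z.of_nat N) / 2.
    by rewrite minus_IZR mult_IZR -!INR_IZR_INZ; field.
  rewrite (rGamma_half_poch _ N); congr (_ * rGamma _).
  by rewrite minus_IZR mult_IZR -!INR_IZR_INZ; field.
by rewrite !e; ring.
Qed.

Lemma KG_coef0 : KG_coef N 0 = 0.
Proof. by rewrite KG_coef_poch flight_coef0; ring. Qed.

(** The arguments drop to -N/2 = 1 - d/2 and to 1/2; the latter is the source of sqrt PI. *)
Lemma KG_coef1 : KG_coef N 1 = (2 * lam * c) ^ N * rGamma (1 - INR N.+2 / 2) / sqrt PI.
Proof.
rewrite KG_coef_rGamma mul1n.
have -> : INR N / 2 - INR N = 1 - INR N.+2 / 2 by rewrite !S_INR; field.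
have -> : INR (N + N.+1) / 2 - INR N = INR 1 / 2 by rewrite plus_INR S_INR /=; field.
rewrite -/(rGamma_half 1) rGamma_half1 -Rpow_mult_distr.
have -> : 4 * c ^ 2 * (lam / (2 * c)) = 2 * lam * c by field; lra.
by [].
Qed.

(** Two terms raise each Gamma argument by N, exactly what the N applications remove, and 4 c^2 (lam
    / 2c)^2 = lam^2. *)
Lemma KG_coefSS (k : nat) :
  KG_coef N k.+2 = lam ^ (2 * N) * flight_coef N (lam / (2 * c)) k.
Proof.
rewrite KG_coef_rGamma /flight_coef /rGamma_half.
have -> : (k.+2 * N = k * N + 2 * N)%N by lia.
have -> : INR (k * N + 2 * N) / 2 - INR N = INR (k * N) / 2.
  by rewrite plus_INR (mult_INR 2) [INR 2]/=; field.
have -> : INR (k * N + 2 * N + N.+1) / 2 - INR N = INR (k * N + N.+1) / 2.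
  have -> : (k * N + 2 * N + N.+1 = k * N + N.+1 + 2 * N)%N by lia.
  by rewrite (plus_INR (k * N + N.+1)) (mult_INR 2) [INR 2]/=; field.
have -> : lam ^ (2 * N) = (4 * c ^ 2) ^ N * (lam / (2 * c)) ^ (2 * N).
  by rewrite !pow_mult -Rpow_mult_distr; congr (_ ^ _); field; lra.
by rewrite pow_add; ring.
Qed.

Lemma KG_flight_equation y t : cone c y t ->
  Nat.iter N (KG c) (fKG c lam) y t =
  lam ^ (2 * N) * fKG c lam y t
  + (2 * lam * c) ^ N * Rpower (interval_sq c y t) (- (INR N.+2 / 2))
    * rGamma (1 - INR N.+2 / 2) / sqrt PI.
Proof.
move=> h; rewrite iter_KG_fKG // (proj1 (is_series_fKG y t h)).
have /(coneE _ _ c0) [t0 w0] := h.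
have r0 := sqrt_lt_R0 _ w0.
have p0 : 0 < sqrt PI by apply: sqrt_lt_R0; apply: PI_RGT_0.
rewrite Rpower_Ropp Rpower_half // /radial.
set r := sqrt _; rewrite -/r in r0.
set A := flight_coef _ _.
have ex0 : ex_pseries (KG_coef N) (r ^ N) by apply: entire_ex_pseries; apply: entire_KG_coef.
have inv : r ^ N = zero \/ exists z, mult z (r ^ N) = one.
  by right; exists (/ r ^ N); rewrite /mult /one /= Rinv_l //; apply: pow_nonzero; lra.
have ex1 := ex_pseries_decr_1 _ _ inv ex0.
(* With the terms k = 0 and k = 1 split off, the tail carries r^(2N), which cancels against r^(2N+2)
   and leaves the index 2 of f. The term k = 1 keeps r^N / r^(2N+2) = w^(-d/2). *)
rewrite PSeries_decr_1 // PSeries_decr_1 //.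
have -> : PSeries (PS_decr_1 (PS_decr_1 (KG_coef N))) (r ^ N) = lam ^ (2 * N) * PSeries A (r ^ N).
  by rewrite -PSeries_scal; apply: PSeries_ext => k; rewrite /PS_decr_1 KG_coefSS.
rewrite KG_coef0 /PS_decr_1 KG_coef1.
have -> : r ^ (2 * N).+2 = r ^ N * r ^ N * r ^ 2.
  by rewrite -!pow_add; congr (_ ^ _); lia.
have -> : r ^ N.+2 = r ^ N * r ^ 2 by rewrite -pow_add; congr (_ ^ _); lia.
by field; repeat split; try (apply: pow_nonzero); lra.
Qed.

End Flight.

Theorem theorem3p3 (d : nat) (c lam : R) :
  (3 <= d)%N -> 0 < c -> 0 < lam ->
  (forall (y : 'I_d -> R) (t : R), cone c y t ->
     is_series
       (fun k => (lam / (2 * c)) ^ (k.+1 * (d - 2))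
          * Rpower (sqrt (c ^ 2 * t ^ 2 - vnorm y ^ 2)) (INR (k.+1 * (d - 2)) - 2)
          * rGamma (INR k.+1 * (INR d / 2 - 1))
          * rGamma ((INR d - 1) / 2 + (INR d / 2 - 1) * INR k.+1))
       (fKG c lam y t))
  /\ smooth_on (@cone d c) (@fKG d c lam)
  /\ (forall (y : 'I_d -> R) (t : R), cone c y t ->
        Nat.iter (d - 2) (@KG d c) (@fKG d c lam) y t
        = lam ^ (2 * (d - 2)) * fKG c lam y t
          + (2 * lam * c) ^ (d - 2)
            * Rpower (c ^ 2 * t ^ 2 - vnorm y ^ 2) (- (INR d / 2))
            * rGamma (1 - INR d / 2) / sqrt PI).
Proof.
case: d => [|[|N]] // N0 c0 lam0.
have -> : (N.+2 - 2 = N)%N by lia.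
split; last split.
- move=> y t h.
  have [_ hs] := is_series_fKG N c lam N0 c0 lam0 y t h.
  apply: is_series_ext hs => k.
  have /(coneE _ _ c0) [t0 w0] := h.
  have r0 := sqrt_lt_R0 _ w0.
  rewrite -/(interval_sq c y t) /flight_coef /rGamma_half /Rminus Rpower_plus Rpower_Ropp.
  rewrite Rpower_pow // (Rpower_pow 2) // pow_powE.
  have -> : INR k.+1 * (INR N.+2 / 2 + - 1) = INR (k.+1 * N) / 2.
    by rewrite mult_INR !S_INR; field.
  have -> : (INR N.+2 + - 1) / 2 + (INR N.+2 / 2 + - 1) * INR k.+1 = INR (k.+1 * N + N.+1) / 2.
    by rewrite plus_INR mult_INR !S_INR; field.
  rewrite /Rdiv; lazymatch goal with |- ?a = ?b => change (a = b :> R) end.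
  by ring.
- apply: (cone_class_smooth _ _ c0 N _
    (fun y t => radial N (flight_coef N (lam / (2 * c))) 2 (interval_sq c y t))).
    apply: cone_class_radial; apply: entire_flight_coef => //.
    by apply: Rlt_le; apply: Rdiv_lt_0_compat; lra.
  by move=> y t h; case: (is_series_fKG N c lam N0 c0 lam0 y t h).
- by move=> y t h; apply: KG_flight_equation.
Qed.
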